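(* Let $\Sigma$ be a fixed finite alphabet. There is a function $B:\mathbb{N}\to\mathbb{N}$ that is single exponential (i.e. $B(N)\le 2^{p(N)}$ for some polynomial $p$, depending only on $|\Sigma|$) such that for every $N$ and any two commutative grammars $G_1,G_2$ in normal form over $\Sigma$ with at most $N$ non-terminals each, writing $B=B(N)$ and $[-B..B]=\{-B,\dots,B\}\subset\mathbb{Z}$: (1) $\Psi(G_1)\subseteq\Psi(G_2)$ if and only if $\Psi(G_1)\cap[-B..B]^\Sigma\subseteq\Psi(G_2)\cap[-B..B]^\Sigma$; and (2) $\Psi(G_1)$ is disjoint from $\Psi(G_2)$ if and only if $\Psi(G_1)\cap[-B..B]^\Sigma$ is disjoint from $\Psi(G_2)\cap[-B..B]^\Sigma$.
   Context: For a finite set $X$ and $v\in\mathbb{R}^X$ let $|v|=\sum_{x\in X}|v_x|$. Elements of $\mathbb{N}^X$ are viewed as multisets over $X$; $[x]\in\mathbb{N}^X$ denotes the singleton multiset of $x$; $x\in s$ for a multiset $s$ means $s_x>0$. A commutative grammar is a tuple $G=(\Sigma,Q,q_I,\delta)$ where $\Sigma$ is a finite alphabet of terminal symbols, $Q$ is a finite set of non-terminal symbols, $q_I\in Q$ is the initial non-terminal, and $\delta\subseteq Q\times\mathbb{Z}^\Sigma\times\mathbb{N}^Q$ is a finite set of transitions. (Terminals may be produced in negative quantities.) For a transition $d=(q,a,t)$ write $\mathrm{source}(d)=q$, $\Psi(d)=a$, $\mathrm{target}(d)=t$. $G$ is in normal form iff every transition $(q,a,t)\in\delta$ satisfies $|t|\le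 2$ and $|a|\le 1$. For $R\in\mathbb{N}^\delta$ let $\mathrm{source}(R)=\sum_{d}R_d[\mathrm{source}(d)]$, $\Psi(R)=\sum_d R_d\Psi(d)$, $\mathrm{target}(R)=\sum_d R_d\,\mathrm{target}(d)$. Write $p\to_R q$ iff some $d\in\delta$ with $R_d>0$ has $\mathrm{source}(d)=p$ and $\mathrm{target}(d)(q)>0$; $\to_R^*$ is the reflexive transitive closure. A run from $p\in Q$ is an $R\in\mathbb{N}^\delta$ such that $\mathrm{source}(R)-[p]=\mathrm{target}(R)$ and $p\to_R^*q$ for every $q\in\mathrm{source}(R)$. The language of $G$ is $\Psi(G)=\{\Psi(R): R \text{ is a run from } q_I\}\subseteq\mathbb{Z}^\Sigma$. *)

(* Defs.v *)
From HB Require Import structures.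
From mathcomp Require Import all_boot all_order all_algebra finmap.
From mathcomp Require Import classical_sets.
Set Implicit Arguments.
Unset Strict Implicit.
Unset Printing Implicit Defensive.
Import Order.TTheory GRing.Theory Num.Theory.
Local Open Scope ring_scope.
Local Open Scope classical_set_scope.

Section Vectors.
Variable X : finType.

Definition norm1 (v : {ffun X -> int}) : nat := (\sum_x `|v x|)%N.

Definition intv (s : {ffun X -> nat}) : {ffun X -> int} :=
  [ffun x => (s x)%:Z].

Definition msingle (x : X) : {ffun X -> nat} := [ffun y => nat_of_bool (y == x)].

Definition box (B : nat) : set {ffun X -> int} :=
  [set v | forall x, - B%:Z <= v x <= B%:Z].

End Vectors.

Record cgrammar (Sigma : finType) := CGrammar {
  nonterm : finType;
  start : nonterm;
  delta : {fset nonterm * {ffun Sigma -> int} * {ffun nonterm -> nat}}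
}.

Section Grammar.
Variables (Sigma : finType) (G : cgrammar Sigma).
Notation Q := (nonterm G).

(* [delta G], used as a type, is the finite type of its elements. *)
Definition tsource (d : delta G) : Q := (val d).1.1.
Definition teffect (d : delta G) : {ffun Sigma -> int} := (val d).1.2.
Definition ttarget (d : delta G) : {ffun Q -> nat} := (val d).2.

Definition normal_form : Prop :=
  forall d : delta G,
    (norm1 (intv (ttarget d)) <= 2)%N /\ (norm1 (teffect d) <= 1)%N.

Section Run.
Variable R : {ffun delta G -> nat}.

Definition source : {ffun Q -> nat} := \sum_d msingle (tsource d) *+ R d.
Definition Psi : {ffun Sigma -> int} := \sum_d teffect d *+ R d.
Definition target : {ffun Q -> nat} := \sum_d ttarget d *+ R d.

Definition step : rel Q := fun p q =>
  [exists d : delta G, [&& (0 < R d)%N, tsource d == p & (0 < ttarget d q)%N]].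

(* The flow equation is stated in Z^Q because subtraction on nat truncates. *)
Definition is_run (p : Q) : Prop :=
  intv source - intv (msingle p) = intv target /\
  forall q : Q, (0 < source q)%N -> connect step p q.

End Run.

Definition language : set {ffun Sigma -> int} :=
  [set Psi R | R in [set R | is_run R (start G)]].

End Grammar.

(* Main.v *)
Require Import Defs.
From mathcomp Require Import all_boot all_order all_algebra finmap.
From mathcomp Require Import classical_sets.
From mathcomp Require Import zify lra.
Import Order.TTheory GRing.Theory Num.Theory.
Set Implicit Arguments.
Unset Strict Implicit.
Unset Printing Implicit Defensive.

(** Write [v = Psi R] for a run [R] of [G1] having a huge multiplicity, and call
    a cycle at [A] a balanced vector of transitions all reachable from [A].

    The single tool is [kernel_direction]: if [x] in [N^J] solves [A x = b] and
    [x j0] is huge, then [A] has a small kernel vector [y] in [N^J] with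
    [y j0 > 0] and [2 y <= x], whose size does not depend on [b].

    Every word of [G2] is, up to a bounded error, a combination of [k = #|Sigma|]
    short cycles at nonterminals [s 0, .., s (k-1)] of its run (Caratheodory).
    For each of the polynomially many [s] such that some combination of short
    cycles at [s] approximates [v], fix one.  Apply [kernel_direction] to the
    system stating that [R] is a flow and that [v] differs from each of the fixed
    combinations by its given bounded error: this gives a balanced [y] with
    [2 y <= R] such that [Psi y] is, for each of these [s], an exact nonnegative
    combination of cycles at [s].  Then [R - y] is a smaller run of [G1]; if [R2] is
    a run of [G2] with [Psi R2 = Psi (R - y)], the combination approximating
    [Psi R2] also approximates [v], so its [s] was considered, and adding the
    corresponding cycles at [s] to [R2] gives a run of [G2] with value [v].
    Hence a word of [G1] that is not in [G2] can be replaced by a smaller one.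
    Disjointness is a direct descent on pairs of runs with equal values. *)

(** * Small solutions of integer linear systems *)

(** Siegel-type bound for [n] unknowns and coefficients up to [a], chosen so that the pigeonhole
    count in [siegel] closes. *)
Definition kbound (n a : nat) : nat := (2 * n * a + 2) ^ n.

Lemma leq_kbound n n' a a' : n <= n' -> a <= a' -> kbound n a <= kbound n' a'.
Proof.
move=> le_n le_a; rewrite /kbound.
apply: (@leq_trans ((2 * n' * a' + 2) ^ n)); last by rewrite leq_pexp2l //; lia.
case: n le_n => // n le_n; rewrite leq_exp2r // leq_add2r.
by rewrite !leq_mul.
Qed.

Local Open Scope ring_scope.

Lemma absz_sum_le (I : finType) (P : pred I) (F : I -> int) :
  (`|(\sum_(i | P i) F i)%R| <= \sum_(i | P i) `|F i|)%N.
Proof.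
elim/big_rec2: _ => [|i m z _ le_zm]; first by [].
by lia.
Qed.

(** Pigeonhole: vectors supported on [A] with entries in [0..H] outnumber the value tuples that the
    [#|I|] linear forms can take on them; the solution is the difference of two colliding
    vectors. *)
Lemma siegel (I J : finType) (a : I -> J -> int) (A : {set J}) (alpha : nat) :
  (#|I| < #|A|)%N -> (forall i j, `|a i j| <= alpha)%N ->
  exists z : J -> int,
    [/\ exists j, z j != 0,
        forall j, j \notin A -> z j = 0,
        forall j, (`|z j| <= kbound #|A| alpha)%N
      & forall i, \sum_j a i j * z j = 0].
Proof.
move=> lt_IA le_a.
set H := kbound #|A| alpha; set W := (#|A| * alpha * H)%N.
pose phi (u : {ffun J -> 'I_H.+1}) i : int := \sum_j a i j * (u j)%:Z.
pose D : {pred {ffun J -> 'I_H.+1}} := [in pffun_on ord0 (mem A) predT].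
have suppD u j : u \in D -> j \notin A -> u j = ord0.
  move=> /pffun_onP[/fintype.subsetP suppA _] jA; apply/eqP/negPn/negP => nz.
  by rewrite suppA in jA.
have phi_le u i : u \in D -> (`|phi u i| <= W)%N.
  move=> uD; apply: leq_trans (absz_sum_le _ _) _.
  rewrite (bigID (mem A)) /= [X in (_ + X)%N]big1 ?addn0; last first.
    by move=> j jA; rewrite (suppD u j) // mulr0.
  rewrite /W -mulnA -sum_nat_const leq_sum // => j _.
  by rewrite abszM leq_mul ?le_a //= -ltnS ltn_ord.
(* Adding [W] moves the values into [0..2W], so [inord] loses nothing on [D]. *)
pose code u : {ffun I -> 'I_(2 * W).+1} :=
  [ffun i => inord `|(phi u i + W%:Z)%R|%N].
have : ~~ dinjectiveb code D.
  apply/negP => /dinjectiveP /leq_card_in.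
  rewrite card_pffun_on card_ffun !card_ord leqNgt => /negP; apply.
  (* With [c = 2 * #|A| * alpha + 2] there are at most [(c * H.+1) ^ #|I|] codes, and
     [c ^ #|I| <= H], hence fewer codes than the [H.+1 ^ #|A|] vectors. *)
  have le_W : ((2 * W).+1 < (2 * #|A| * alpha + 2) * H.+1)%N.
    by rewrite /W -(mulnA 2); move: (#|A| * alpha)%N => c; nia.
  have ltH : ((2 * #|A| * alpha + 2) ^ #|I| <= H)%N.
    by rewrite /H /kbound leq_pexp2l //; lia.
  apply: (@leq_ltn_trans (((2 * #|A| * alpha + 2) * H.+1) ^ #|I|)).
    by case: {+}#|I| => // m; rewrite leq_exp2r // ltnW.
  rewrite expnMn; apply: (@leq_trans (H.+1 ^ #|I|.+1)).
    by rewrite expnS ltn_pmul2r ?expn_gt0 // ltnS.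
  by rewrite leq_pexp2l.
case/dinjectivePn => u uD [u' /andP[/= neq_u uD'] eq_code].
exists (fun j => (u j)%:Z - (u' j)%:Z); split.
- have /forallPn[j] : ~~ [forall j, u j == u' j].
    by apply: contra neq_u => /eqfunP eq_u; apply/eqP/ffunP => j; rewrite eq_u.
  by exists j; rewrite subr_eq0 eqz_nat.
- by move=> j jA; rewrite !(suppD _ j) // subrr.
- by move=> j; have := ltn_ord (u j); have := ltn_ord (u' j); lia.
- move=> i; under eq_bigr do rewrite mulrBr.
  rewrite sumrB; apply/eqP; rewrite subr_eq0; apply/eqP.
  have /ffunP/(_ i)/(congr1 val) := eq_code; rewrite !ffunE /=.
  have := phi_le u i uD; have := phi_le u' i uD'; rewrite /phi.
  by move: (\sum_j _) => x; move: (\sum_j _) => y ? ?; rewrite !inordK; lia.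
Qed.

(* The rows [inr j'] of the matrix force the kernel vector to vanish outside [C];
   restricting to a maximal independent set of rows makes [siegel] applicable. *)
Lemma small_kernel (I J : finType) (a : I -> J -> int) (C : {set J})
    (alpha : nat) (x : J -> rat) :
  (0 < alpha)%N -> (forall i j, j \in C -> (`|a i j| <= alpha)%N) ->
  (exists j, x j != 0) -> (forall j, j \notin C -> x j = 0) ->
  (forall i, \sum_j (a i j)%:~R * x j = 0) ->
  exists z : J -> int,
    [/\ exists j, z j != 0,
        forall j, j \notin C -> z j = 0,
        forall j, (`|z j| <= kbound #|J| alpha)%N
      & forall i, \sum_j a i j * z j = 0].
Proof.
move=> alpha_gt0 le_a [j0 nz_x] xC ker_x.
pose b (r : I + J) j : int := match r with
  | inl i => if j \in C then a i j else 0
  | inr j' => ((j' == j) && (j \notin C))%:Z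
  end.
have ker_bx r : \sum_j (b r j)%:~R * x j = 0.
  case: r => [i|j'] /=; last first.
    by rewrite big1 // => j _; case: (boolP (j \in C)) => [|/xC ->];
      rewrite ?andbF ?mul0r ?mulr0.
  rewrite -[RHS](ker_x i); apply: eq_bigr => j _.
  by case: ifP => // /negbT /xC ->; rewrite !mulr0.
have le_b r j : (`|b r j| <= alpha)%N.
  case: r => [i|j'] /=; first by case: ifP => // /le_a.
  by case: (_ && _).
pose M : 'M[rat]_(#|{: I + J}|, #|J|) :=
  \matrix_(r, c) (b (enum_val r) (enum_val c))%:~R.
have mulME (y : J -> rat) r :
    (M *m \col_c y (enum_val c)) r 0 = \sum_j (b (enum_val r) j)%:~R * y j.
  rewrite mxE [RHS](reindex (@enum_val _ (mem J))) /=; last first.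
    by apply: onW_bij; apply: enum_val_bij.
  by apply: eq_bigr => c _; rewrite !mxE.
have rank_lt : (\rank M < #|J|)%N.
  rewrite ltn_neqAle rank_leq_col andbT; apply/negP => /row_fullP[B BM].
  have : M *m (\col_c x (enum_val c)) = 0.
    by apply/matrixP => r c; rewrite ord1 mulME ker_bx mxE.
  move/(congr1 (mulmx B)); rewrite mulmxA BM mul1mx mulmx0.
  move=> /matrixP/(_ (enum_rank j0) 0); rewrite !mxE enum_rankK => x0.
  by rewrite x0 eqxx in nz_x.
pose f := maxrankfun M.
have [||z [nz_z _ le_z ker_z]] :=
  @siegel 'I_(\rank M) J (fun r j => b (enum_val (f r)) j) finset.setT alpha.
- by rewrite card_ord cardsT.
- by move=> r j.
rewrite cardsT in le_z.
have ker_bz r : \sum_j b r j * z j = 0.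
  have : M *m (\col_c (z (enum_val c))%:~R) = 0.
    have /submxP[B ->] : (M <= rowsub f M)%MS by rewrite eq_maxrowsub.
    rewrite -mulmxA mul_rowsub_mx.
    suff -> : rowsub f (M *m \col_c (z (enum_val c))%:~R) = 0 by rewrite mulmx0.
    apply/matrixP => i c; rewrite ord1 mxE (mulME (fun j => (z j)%:~R)) mxE.
    under eq_bigr do rewrite -intrM.
    by rewrite -rmorph_sum /= ker_z.
  move=> /matrixP/(_ (enum_rank r) 0).
  rewrite (mulME (fun j => (z j)%:~R)) mxE enum_rankK.
  under eq_bigr do rewrite -intrM.
  by rewrite -rmorph_sum /= => /eqP; rewrite intr_eq0 => /eqP.
have zC j : j \notin C -> z j = 0.
  move=> jC; have := ker_bz (inr j); rewrite (bigD1 j) //= eqxx jC mul1r.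
  rewrite big1 ?addr0 // => j' /negbTE neq_j.
  by rewrite eq_sym neq_j mul0r.
exists z; split=> // i.
rewrite -[RHS](ker_bz (inl i)); apply: eq_bigr => j _ /=.
by case: ifP => // /negbT /zC ->; rewrite !mulr0.
Qed.

(** Induction on the support of [x]. A small kernel vector [z] on this support is the answer, up to
    sign, if its entries do not change sign. Otherwise subtracting the largest multiple of [z] that
    keeps [x] nonnegative shrinks the support, and a negative entry of [z] keeps the result
    nonzero. *)
Lemma small_circuit (I J : finType) (a : I -> J -> int) (alpha : nat)
    (x : J -> rat) :
  (0 < alpha)%N -> (forall i j, x j != 0 -> (`|a i j| <= alpha)%N) ->
  (forall j, 0 <= x j) -> (exists j, x j != 0) ->
  (forall i, \sum_j (a i j)%:~R * x j = 0) ->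
  exists y : J -> nat,
    [/\ exists j, y j != 0%N,
        forall j, x j = 0 -> y j = 0%N,
        forall j, (y j <= kbound #|J| alpha)%N
      & forall i, \sum_j a i j * (y j)%:Z = 0].
Proof.
move=> alpha_gt0.
have [s] := ubnP #|[set j | x j != 0]|.
elim: s x => // s IHs x; rewrite ltnS => le_s le_a x_ge0 nz_x ker_x.
have [||z0 [nz_z zC le_z ker_z]] :=
  @small_kernel _ _ a [set j | x j != 0] alpha x alpha_gt0 _ nz_x _ ker_x.
- by move=> i j; rewrite inE => /le_a.
- by move=> j; rewrite inE negbK => /eqP.
have {nz_z zC le_z ker_z} [z [[j0 z_gt0] zC le_z ker_z]] :
    exists z : J -> int, [/\ exists j, 0 < z j, forall j, x j = 0 -> z j = 0,
        forall j, (`|z j| <= kbound #|J| alpha)%N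
      & forall i, \sum_j a i j * z j = 0].
  have zC' j : x j = 0 -> z0 j = 0 by move=> xj; rewrite zC ?inE ?xj ?eqxx.
  have [j0 nz] := nz_z; have [z_gt0|z_le0] := ltrP 0 (z0 j0).
    by exists z0; split=> //; exists j0.
  exists (fun j => - z0 j); split.
  - by exists j0; rewrite oppr_gt0 lt_neqAle nz.
  - by move=> j /zC' ->; rewrite oppr0.
  - by move=> j; rewrite abszN.
  - by move=> i; under eq_bigr do rewrite mulrN; rewrite sumrN ker_z oppr0.
have [/forallP z_ge0|/forallPn[j1]] := boolP [forall j, 0 <= z j].
  exists (fun j => `|z j|%N); split.
  - by exists j0; rewrite absz_eq0 gt_eqF.
  - by move=> j /zC ->.
  - exact: le_z.
  - by move=> i; rewrite -[RHS](ker_z i); apply: eq_bigr => j _; rewrite gez0_abs.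
rewrite -ltNge => z_lt0.
pose r j : rat := x j / (z j)%:~R.
have [jm zm_gt0 min_r] := @arg_minP _ _ _ j0 (fun j => 0 < z j) r z_gt0.
have rm_gt0 : 0 < r jm.
  rewrite divr_gt0 ?ltr0z // lt_neqAle x_ge0 andbT eq_sym.
  by apply: contraTN zm_gt0 => /eqP /zC ->.
pose x' j := x j - r jm * (z j)%:~R.
have x'C j : x j = 0 -> x' j = 0.
  by move=> xj; rewrite /x' xj (zC j xj) mulr0 subr0.
have [|||||y [nz_y yC le_y ker_y]] := IHs x'.
- apply: leq_trans le_s; rewrite [X in (_ < X)%N](cardsD1 jm) inE.
  have -> /= : x jm != 0 by apply: contraTN zm_gt0 => /eqP /zC ->.
  rewrite ltnS; apply: subset_leq_card; apply/fintype.subsetP => j.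
  rewrite !inE => nz'; apply/andP; split; last first.
    by apply: contraNN nz' => /eqP /x'C ->.
  apply: contraNneq nz' => ->; rewrite /x' /r divfK ?subrr //.
  by rewrite intr_eq0 gt_eqF.
- by move=> i j nz'; apply: le_a; apply: contraNN nz' => /eqP /x'C ->.
- move=> j; rewrite subr_ge0; have [zj|zj] := ltrP 0 (z j).
    by rewrite -ler_pdivlMr ?ltr0z //; exact: min_r.
  by rewrite (le_trans _ (x_ge0 j)) // pmulr_rle0 // lerz0.
- exists j1; rewrite gt_eqF // /x' subr_gt0 (lt_le_trans _ (x_ge0 j1)) //.
  by rewrite pmulr_rlt0 // ltrz0.
- move=> i; under eq_bigr do rewrite mulrBr mulrCA -intrM.
  by rewrite sumrB ker_x -mulr_sumr -rmorph_sum /= ker_z mulr0 subr0.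
by exists y; split=> // j /x'C /yC.
Qed.

(* Column [st] carries the right-hand side of a homogenized system, so only its
   entries may be large; peeling off circuits that use it costs at most
   [kbound #|J| alpha'] at [j0], because [x st <= 1]. *)
Lemma kernel_below (I J : finType) (a : I -> J -> int) (st : J)
    (alpha alpha' L : nat) (s : nat) (x : J -> rat) (j0 : J) :
  (0 < alpha)%N -> (0 < alpha')%N ->
  (forall i j, j != st -> (`|a i j| <= alpha)%N) ->
  (forall i j, (`|a i j| <= alpha')%N) ->
  (#|[set j | (x j != 0)%R]| <= s)%N ->
  (forall j, 0 <= x j) -> x st <= 1 ->
  (forall i, \sum_j (a i j)%:~R * x j = 0) ->
  (s * (kbound #|J| alpha' + L * kbound #|J| alpha))%:R < x j0 ->
  exists y : J -> nat,
    [/\ forall i, \sum_j a i j * (y j)%:Z = 0,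
        y st = 0%N,
        (0 < y j0)%N,
        forall j, (y j <= kbound #|J| alpha)%N
      & forall j, (L * y j)%:R <= x j].
Proof.
move=> alpha_gt0 alpha'_gt0 le_a le_a'.
set Y := kbound #|J| alpha; set Y' := kbound #|J| alpha'.
elim: s x => [|s IHs] x le_s x_ge0 x_st ker_x.
  move: le_s; rewrite leqn0 cards_eq0 => /eqP s0.
  have -> : x j0 = 0.
    by apply/eqP; apply/negPn/negP => nz; have := finset.in_set0 j0; rewrite -s0 inE nz.
  by rewrite ltxx.
move=> big_x.
have nz_x : exists j, x j != 0.
  by exists j0; rewrite gt_eqF // (le_lt_trans _ big_x).
have ker_rat (y : J -> nat) : (forall i, \sum_j a i j * (y j)%:Z = 0) ->
    forall i, \sum_j (a i j)%:~R * (y j)%:R = 0 :> rat.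
  move=> ker_y i; rewrite -[RHS](rmorph0 (intmul 1)) -(ker_y i) rmorph_sum /=.
  by apply: eq_bigr => j _; rewrite intrM.
(* A first circuit that avoids [st] is only known to be below [Y']; a second circuit inside its
   support sees only the columns bounded by [alpha]. *)
have [y [nz_y yC le_y le_y' ker_y]] : exists y : J -> nat,
    [/\ exists j, y j != 0%N, forall j, x j = 0 -> y j = 0%N,
        forall j, (y j <= Y')%N,
        y st = 0%N -> forall j, (y j <= Y)%N
      & forall i, \sum_j a i j * (y j)%:Z = 0].
  have [y [nz_y yC le_y ker_y]] :=
    small_circuit alpha'_gt0 (fun i j _ => le_a' i j) x_ge0 nz_x ker_x.
  have [y_st|y_st] := eqVneq (y st) 0%N; last first.
    by exists y; split=> // y_st0; rewrite y_st0 in y_st.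
  have [|||||y2 [nz_y2 y2C le_y2 ker_y2]] :=
    @small_circuit _ _ a (minn alpha alpha') (fun j => (y j)%:R).
  - by rewrite leq_min alpha_gt0.
  - move=> i j; rewrite pnatr_eq0 => nz_yj; rewrite leq_min le_a' andbT.
    by apply: le_a; apply: contraNneq nz_yj => ->; rewrite y_st.
  - by move=> j; rewrite ler0n.
  - by have [j nz_yj] := nz_y; exists j; rewrite pnatr_eq0.
  - exact: ker_rat.
  exists y2; split=> //.
  - by move=> j /yC yj; apply: y2C; rewrite yj.
  - by move=> j; rewrite (leq_trans (le_y2 j)) ?leq_kbound ?geq_minr.
  - by move=> _ j; rewrite (leq_trans (le_y2 j)) ?leq_kbound ?geq_minl.
have [j1 /= nz_j1] := nz_y.
pose r j : rat := x j / (y j)%:R.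
have [jm nz_jm min_r] := @arg_minP _ _ _ j1 (fun j => y j != 0%N) r nz_j1.
(* [lam] is the largest multiple of [y] that fits under [x]; the remainder vanishes at [jm]. *)
set lam := r jm in min_r.
have lam_ge0 : 0 <= lam by rewrite divr_ge0.
pose x' j := x j - lam * (y j)%:R.
have x'_ge0 j : 0 <= x' j.
  rewrite subr_ge0; have [->|nz] := eqVneq (y j) 0%N; first by rewrite mulr0.
  by rewrite -ler_pdivlMr ?ltr0n ?lt0n //; apply: min_r.
have le_x' j : x' j <= x j by rewrite lerBlDr lerDl mulr_ge0.
have [big_x'|small_x'] := ltrP (s * (Y' + L * Y))%:R (x' j0).
  have [|||y' [ker_y' y'_st y'_j0 le_y'' le_Ly']] := IHs x' _ x'_ge0 _ _ big_x'.
  - rewrite -ltnS; apply: leq_trans le_s; apply: proper_card.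
    rewrite properE; apply/andP; split.
      apply/fintype.subsetP => j; rewrite !inE; apply: contraNN => /eqP xj.
      by rewrite eq_le x'_ge0 (le_trans (le_x' j)) ?xj.
    apply/negP => /fintype.subsetP/(_ jm); rewrite !inE.
    have -> : x jm != 0 by apply: contraNneq nz_jm => /yC ->.
    move=> /(_ isT)/negP; apply.
    by rewrite /x' /lam /r divfK ?subrr // pnatr_eq0.
  - exact: le_trans (le_x' st) x_st.
  - move=> i; under eq_bigr do rewrite mulrBr mulrCA.
    by rewrite sumrB ker_x -mulr_sumr (ker_rat y) // mulr0 subr0.
  by exists y'; split=> // j; rewrite (le_trans (le_Ly' j)).
(* The remainder is small at [j0], so this single circuit took away more than [Y' + L * Y] there. *)
have big_lam : (Y' + L * Y)%:R < lam * (y j0)%:R.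
  move: small_x' big_x; rewrite /x' mulSn natrD.
  by set u : rat := (s * _)%:R; set w : rat := (Y' + _)%:R; lra.
have y_gt0 : (0 < y j0)%N.
  rewrite lt0n; apply: contraTneq big_lam => ->.
  by rewrite mulr0 -leNgt ler0n.
have le_lam j : lam * (y j)%:R <= x j by have := x'_ge0 j; rewrite subr_ge0.
(* A circuit through [st] is impossible: [x st <= 1] forces [lam <= 1], so it takes away at most
   [Y'] at [j0]. *)
have [y_st|y_st] := eqVneq (y st) 0%N; last first.
  have lam1 : lam <= 1.
    apply: le_trans (le_trans (le_lam st) x_st).
    by rewrite ler_peMr // (ler_nat _ 1) lt0n.
  suff : lam * (y j0)%:R <= (Y' + L * Y)%:R by rewrite leNgt big_lam.
  apply: (@le_trans _ _ (y j0)%:R); first by rewrite ler_piMl.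
  by rewrite ler_nat (leq_trans (le_y j0)) ?leq_addr.
exists y; split=> //; first exact: le_y'.
(* [lam * y j0] exceeds [L * Y], which is at least [L * y j0]; hence [L <= lam]. *)
move=> j; apply: le_trans (le_lam j); rewrite natrM ler_wpM2r //.
rewrite -(@ler_pM2r _ (y j0)%:R) ?ltr0n //; apply: ltW.
apply: le_lt_trans big_lam; rewrite -natrM ler_nat.
by rewrite (leq_trans _ (leq_addl _ _)) // leq_mul2l le_y' ?orbT.
Qed.

(** A homogenized system has at most [n.+1] columns, hence at most [n.+1] circuits to peel, each at
    the cost allowed in [kernel_below]; [a + b] bounds all its entries. *)
Definition xbound (n a b L : nat) : nat :=
  n.+1 * (kbound n.+1 (a + b) + L * kbound n.+1 a).

(** The right-hand side becomes a column [None] with entries [- b i], where [x'] is 1. The direction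
    found is zero there, so it solves the homogeneous system and its size does not involve
    [beta]. *)
Lemma kernel_direction (I J : finType) (a : I -> J -> int) (b : I -> int)
    (alpha beta L n : nat) (x : J -> nat) (j0 : J) :
  (0 < alpha)%N -> (#|J| <= n)%N ->
  (forall i j, (`|a i j| <= alpha)%N) -> (forall i, (`|b i| <= beta)%N) ->
  (forall i, \sum_j a i j * (x j)%:Z = b i) ->
  (xbound n alpha beta L < x j0)%N ->
  exists y : J -> nat,
    [/\ forall i, \sum_j a i j * (y j)%:Z = 0,
        (0 < y j0)%N,
        forall j, (y j <= kbound n.+1 alpha)%N
      & forall j, (L * y j <= x j)%N].
Proof.
move=> alpha_gt0 le_n le_a le_b eq_b big_x.
pose a' i (j : option J) : int := if j is Some j then a i j else - b i.
pose x' (j : option J) : rat := if j is Some j then (x j)%:R else 1.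
have sumE (R : nmodType) (F : option J -> R) :
    \sum_j F j = F None + \sum_j F (Some j).
  rewrite (bigD1 None) //=; congr (_ + _).
  rewrite (reindex_omap Some id) //=; last by case.
  by apply: eq_bigl => j /=; rewrite eqxx.
have [||||||||y [ker_y y_st y_j0 le_y le_Ly]] :=
  @kernel_below I (option J) a' None alpha (alpha + beta) L #|{: option J}| x'
    (Some j0) alpha_gt0.
- by rewrite addn_gt0 alpha_gt0.
- by move=> i [j|] //= _.
- move=> i [j|] /=; first by rewrite (leq_trans (le_a i j)) ?leq_addr.
  by rewrite abszN (leq_trans (le_b i)) ?leq_addl.
- exact: max_card.
- by case=> [j|] //=.
- by [].
- move=> i; rewrite sumE /= mulr1 rmorphN /= -eq_b rmorph_sum /=.
  by under [in X in - X]eq_bigr do rewrite intrM; rewrite addNr.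
- rewrite ltr_nat (leq_ltn_trans _ big_x) // card_option /xbound.
  by rewrite leq_mul ?leq_add ?leq_mul ?leq_kbound.
exists (fun j => y (Some j)); split=> //.
- by move=> i; have := ker_y i; rewrite sumE /= y_st mulr0 add0r.
- by move=> j; rewrite (leq_trans (le_y _)) // leq_kbound // card_option.
- by move=> j; have := le_Ly (Some j); rewrite ler_nat.
Qed.

(** If more than [#|I|] coefficients are large, [siegel] yields a small integer relation between
    [#|I|.+1] of their generators. Moving along it preserves the sum and makes one of them small,
    while coefficients outside [A] stay fixed. *)
Lemma integer_caratheodory (I T : finType) (p : T -> I -> int) (M : nat)
    (n : T -> nat) :
  (forall t i, (`|p t i| <= M)%N) ->
  exists n' : T -> nat,
    [/\ forall i, \sum_t p t i * (n' t)%:Z = \sum_t p t i * (n t)%:Z,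
        forall t, n t = 0%N -> n' t = 0%N
      & (#|[set t | kbound #|I|.+1 M < n' t]| <= #|I|)%N].
Proof.
move=> le_p; set H := kbound #|I|.+1 M.
have [s] := ubnP #|[set t | (H < n t)%N]|.
elim: s n => // s IHs n; rewrite ltnS => le_s.
have [few|] := leqP #|[set t | (H < n t)%N]| #|I|; first by exists n; split.
set big := [set t | (H < n t)%N]%SET => many.
have [A /andP[sAbig /eqP cardA]] :
    exists A : {set T}, (A \subset big) && (#|A| == #|I|.+1).
  have : (0 < #|[set A : {set T} | (A \subset big) && (#|A| == #|I|.+1)]|)%N.
    by rewrite cards_draws bin_gt0.
  by rewrite card_gt0 => /set0Pn[A]; rewrite inE => ?; exists A.
have [||z0 [[t0 nz_z] zA le_z ker_z]] := @siegel I T (fun i t => p t i) A M.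
- by rewrite cardA.
- by move=> i t.
rewrite cardA -/H in le_z.
have {t0 nz_z zA le_z ker_z} [z [[t0 z_gt0] zA le_z ker_z]] :
    exists z : T -> int, [/\ exists t, 0 < z t, forall t, t \notin A -> z t = 0,
        forall t, (`|z t| <= H)%N & forall i, \sum_t p t i * z t = 0].
  have [z_gt0|z_le0] := ltrP 0 (z0 t0).
    by exists z0; split=> //; exists t0.
  exists (fun t => - z0 t); split.
  - by exists t0; rewrite oppr_gt0 lt_neqAle nz_z.
  - by move=> t /zA ->; rewrite oppr0.
  - by move=> t; rewrite abszN.
  - by move=> i; under eq_bigr do rewrite mulrN; rewrite sumrN ker_z oppr0.
(* Move as far as nonnegativity permits; [z t0 > 0] bounds [c]. Where one more step would fail, the
   remaining coefficient is below [z t1 <= H]. *)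
pose ok c := [forall t, c%:Z * z t <= (n t)%:Z].
have ok0 : exists c, ok c by exists 0%N; apply/forallP => t; rewrite mul0r.
have ok_le c : ok c -> (c <= n t0)%N.
  by move=> /forallP/(_ t0); move: z_gt0 => z_gt0 ?; nia.
have [c /forallP ok_c max_c] := ex_maxnP ok0 ok_le.
have /forallPn[t1] : ~~ ok c.+1 by apply/negP => /max_c; rewrite ltnn.
rewrite -ltNge => lt_t1.
have t1A : t1 \in A.
  by apply: contraLR lt_t1 => /zA ->; rewrite mulr0 -leNgt.
pose n1 t := `|((n t)%:Z - c%:Z * z t)%R|%N.
have n1E t : (n1 t)%:Z = (n t)%:Z - c%:Z * z t.
  by rewrite /n1 gez0_abs // subr_ge0 ok_c.
have n1A t : t \notin A -> n1 t = n t.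
  by move=> /zA zt; have := n1E t; rewrite zt mulr0 subr0 => -[].
have [|n' [eq_n' n'C few]] := IHs n1.
  apply: leq_trans le_s; apply: proper_card; rewrite properE; apply/andP; split.
    apply/fintype.subsetP => t; rewrite inE.
    have [/(fintype.subsetP sAbig)//|/n1A ->] := boolP (t \in A).
    by rewrite inE.
  apply/negP => /fintype.subsetP/(_ t1).
  move=> /(_ (fintype.subsetP sAbig _ t1A)); rewrite inE.
  have := n1E t1; have := le_z t1; have := ok_c t1; move: lt_t1.
  by rewrite intS mulrDl mul1r; lia.
exists n'; split=> //.
- move=> i; rewrite eq_n'; under eq_bigr do rewrite n1E mulrBr mulrCA.
  by rewrite sumrB -mulr_sumr ker_z mulr0 subr0.
- move=> t nt; apply: n'C; rewrite n1A //.
  by apply/negP => /(fintype.subsetP sAbig); rewrite inE nt.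
Qed.

(** * Runs and cycles *)

Section Runs.
Variables (Sigma : finType) (G : cgrammar Sigma).
Notation Q := (nonterm G).
Notation vec := {ffun delta G -> nat}.
Implicit Types (R h y : vec) (p q A : Q).

Definition balanced R : Prop := forall q, source R q = target R q.

(** Targets branch, so this is not a closed path but a vector that can be inserted into any run
    visiting [A]. The zero vector is a cycle at every nonterminal. *)
Definition cycle_at A R : Prop :=
  balanced R /\ forall q, (0 < source R q)%N -> connect (step R) A q.

Definition flow_coef q (d : delta G) : int :=
  (tsource d == q)%:Z - (ttarget d q)%:Z.

Lemma ffun_natmulE (T : finType) (V : nmodType) (f : {ffun T -> V}) n x :
  (f *+ n) x = f x *+ n.
Proof. by elim: n => [|n IHn]; rewrite ?mulr0n ?ffunE // !mulrS ffunE IHn. Qed.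

Lemma sourceE R q : source R q = (\sum_d (tsource d == q) * R d)%N.
Proof.
rewrite sum_ffunE; apply: eq_bigr => d _.
by rewrite ffun_natmulE ffunE eq_sym -mulr_natr natn.
Qed.

Lemma targetE R q : target R q = (\sum_d ttarget d q * R d)%N.
Proof.
rewrite sum_ffunE; apply: eq_bigr => d _.
by rewrite ffun_natmulE -mulr_natr natn.
Qed.

Lemma PsiE R x : Psi R x = \sum_d teffect d x * (R d)%:Z.
Proof.
rewrite sum_ffunE; apply: eq_bigr => d _.
by rewrite ffun_natmulE -mulr_natr natz.
Qed.

Lemma source_gt0P R q :
  reflect (exists2 d, (0 < R d)%N & tsource d = q) (0 < source R q)%N.
Proof.
rewrite sourceE lt0n sum_nat_eq0 negb_forall; apply: (iffP existsP) => -[d].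
  by rewrite negb_imply /= muln_eq0 negb_or eqb0 negbK => /andP[/eqP <-];
    rewrite -lt0n; exists d.
by move=> R_d <-; exists d; rewrite negb_imply /= muln_eq0 eqxx /= -lt0n.
Qed.

Lemma target_gt0P R q :
  reflect (exists2 d, (0 < R d)%N & (0 < ttarget d q)%N) (0 < target R q)%N.
Proof.
rewrite targetE lt0n sum_nat_eq0 negb_forall; apply: (iffP existsP) => -[d].
  by rewrite negb_imply /= muln_eq0 negb_or -!lt0n => /andP[]; exists d.
by move=> R_d t_d; exists d; rewrite negb_imply /= muln_eq0 negb_or -!lt0n t_d.
Qed.

Lemma stepP R p q :
  reflect (exists d, [/\ (0 < R d)%N, tsource d = p & (0 < ttarget d q)%N])
          (step R p q).
Proof.
apply: (iffP existsP) => -[d]; first by case/and3P => ? /eqP ? ?; exists d.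
by case=> ? /eqP ? ?; exists d; apply/and3P.
Qed.

Lemma step_connect_sub R R' :
  (forall d, (0 < R d)%N -> (0 < R' d)%N) ->
  subrel (connect (step R)) (connect (step R')).
Proof.
move=> sRR'; apply: connect_sub => p q /stepP[d [R_d src_d tgt_d]].
by apply/connect1/stepP; exists d; split=> //; apply: sRR'.
Qed.

Lemma vecDE R h d : (R + h) d = (R d + h d)%N.
Proof. by rewrite ffunE. Qed.

Lemma sourceD R h q : source (R + h) q = (source R q + source h q)%N.
Proof.
by rewrite !sourceE -big_split /=; apply: eq_bigr => d _; rewrite vecDE -mulnDr.
Qed.

Lemma targetD R h q : target (R + h) q = (target R q + target h q)%N.
Proof.
by rewrite !targetE -big_split /=; apply: eq_bigr => d _; rewrite vecDE -mulnDr.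
Qed.

Lemma PsiD R h x : Psi (R + h) x = Psi R x + Psi h x.
Proof.
rewrite !PsiE -big_split /=; apply: eq_bigr => d _.
by rewrite vecDE PoszD mulrDr.
Qed.

Lemma flow_coefE R q :
  \sum_d flow_coef q d * (R d)%:Z = (source R q)%:Z - (target R q)%:Z.
Proof.
under eq_bigr do rewrite mulrBl.
rewrite sumrB sourceE targetE !(big_morph _ PoszD (erefl 0%:Z)).
by congr (_ - _); apply: eq_bigr => d _; rewrite PoszM.
Qed.

Lemma balancedP R :
  balanced R <-> forall q, \sum_d flow_coef q d * (R d)%:Z = 0.
Proof.
split=> bal q; first by rewrite flow_coefE bal subrr.
by have := bal q; rewrite flow_coefE => /subr0_eq [].
Qed.

Lemma is_runP R p :
  is_run R p <->
  (forall q, \sum_d flow_coef q d * (R d)%:Z = (q == p)%:Z) /\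
  (forall q, (0 < source R q)%N -> connect (step R) p q).
Proof.
split=> -[flow conn]; split=> //.
  move=> q; have /ffunP/(_ q) := flow; rewrite !ffunE flow_coefE.
  by move=> <-; rewrite opprB addrC subrK.
apply/ffunP => q; rewrite !ffunE; have := flow q; rewrite flow_coefE => <-.
by rewrite opprB addrC subrK.
Qed.

Lemma start_source R p : is_run R p -> (0 < source R p)%N.
Proof.
case/is_runP => /(_ p); rewrite flow_coefE eqxx => flow _.
by lia.
Qed.

Lemma cycle0 A : cycle_at A 0.
Proof.
have src0 q : source (0 : vec) q = 0%N.
  by rewrite sourceE big1 // => d _; rewrite ffunE muln0.
split=> q; rewrite src0 // targetE big1 // => d _.
by rewrite ffunE muln0.
Qed.

Lemma cycleD A R h : cycle_at A R -> cycle_at A h -> cycle_at A (R + h).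
Proof.
move=> [balR connR] [balh connh]; split=> q.
  by rewrite sourceD targetD balR balh.
rewrite sourceD addn_gt0 => /orP[/connR|/connh]; apply: step_connect_sub.
  by move=> d; rewrite vecDE addn_gt0 => ->.
by move=> d; rewrite vecDE addn_gt0 => ->; rewrite orbT.
Qed.

Lemma cycleMn A R n : cycle_at A R -> cycle_at A (R *+ n).
Proof.
move=> cycR; elim: n => [|n IHn]; first exact: cycle0.
by rewrite mulrS; apply: cycleD.
Qed.

Lemma run_add_cycle R h p A :
  is_run R p -> (0 < source R A)%N -> cycle_at A h -> is_run (R + h) p.
Proof.
move=> /is_runP[flow conn] R_A [bal connh]; apply/is_runP; split=> q.
  by have := flow q; rewrite !flow_coefE sourceD targetD bal => <-; lia.
have R_le d : (0 < R d)%N -> (0 < (R + h)%R d)%N.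
  by rewrite vecDE addn_gt0 => ->.
rewrite sourceD addn_gt0 => /orP[/conn|/connh A_q].
  exact: step_connect_sub.
apply: connect_trans (step_connect_sub R_le (conn A R_A)) _.
by apply: step_connect_sub A_q => d; rewrite vecDE addn_gt0 orbC => ->.
Qed.

(** The factor 2 preserves the support: a transition used in [R] remains used after the subtraction,
    so reachability survives. *)
Lemma run_sub_balanced R y p :
  is_run R p -> balanced y -> (forall d, (2 * y d <= R d)%N) ->
  is_run [ffun d => (R d - y d)%N] p.
Proof.
move=> /is_runP[flow conn] /balancedP bal le_y; apply/is_runP; split=> q.
  rewrite -(flow q) -[RHS]subr0 -[X in _ = _ - X](bal q) -sumrB; apply: eq_bigr => d _.
  by rewrite ffunE -mulrBr; congr (_ * _); have := le_y d; lia.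
case/source_gt0P => d; rewrite ffunE => y_d src_d.
apply: (@step_connect_sub R) => [d'|].
  by rewrite ffunE; have := le_y d'; lia.
apply: conn; apply/source_gt0P; exists d => //.
by rewrite (leq_trans y_d) ?leq_subr.
Qed.

Lemma subvecK R y :
  (forall d, (2 * y d <= R d)%N) -> [ffun d => (R d - y d)%N] + y = R.
Proof.
move=> le_y; apply/ffunP => d; rewrite vecDE ffunE subnK //.
by apply: leq_trans (le_y d); rewrite mul2n -addnn leq_addl.
Qed.

Lemma Psi_sub R y x :
  (forall d, (2 * y d <= R d)%N) ->
  Psi [ffun d => (R d - y d)%N] x = Psi R x - Psi y x.
Proof. by move=> le_y; rewrite -{2}(subvecK le_y) PsiD addrK. Qed.

Lemma sum_sub_lt R y d0 :
  (forall d, (2 * y d <= R d)%N) -> (0 < y d0)%N ->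
  (\sum_d [ffun d => (R d - y d)%N] d < \sum_d R d)%N.
Proof.
move=> le_y y_d0; rewrite (bigD1 d0) //= [X in (_ < X)%N](bigD1 d0) //=.
rewrite -addSn; apply: leq_add.
  by rewrite ffunE; have := le_y d0; lia.
by apply: leq_sum => d _; rewrite ffunE leq_subr.
Qed.

(** The transitions of [y] leaving the component of a suitable [A] consume no nonterminal more than
    they produce it. The surplus is then consumed by adding transitions of [y] one at a time, which
    ends in a balanced vector because [y] is balanced. *)
Lemma balanced_cycle y (d0 : delta G) :
  balanced y -> (0 < y d0)%N ->
  exists h A, [/\ forall d, (h d <= y d)%N, exists d, (0 < h d)%N,
                  (0 < source y A)%N & cycle_at A h].
Proof.
move=> bal y_d0.
have y_q0 : (0 < source y (tsource d0))%N by apply/source_gt0P; exists d0.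
have [A y_A max_A] := @arg_maxnP _ (tsource d0) (fun q => 0 < source y q)%N
  (fun q => #|connect (step y) q|) y_q0.
pose K q := connect (step y) A q && connect (step y) q A.
have K_A : K A by rewrite /K connect0.
(* [A] reaches as many nonterminals as possible, so its strongly connected
   component [K] is fed from inside [K] only. *)
have K_back d q : (0 < y d)%N -> (0 < ttarget d q)%N -> K q -> K (tsource d).
  move=> y_d tgt_d /andP[A_q q_A].
  have d_A : connect (step y) (tsource d) A.
    by apply: connect_trans (connect1 _) q_A; apply/stepP; exists d.
  rewrite /K d_A andbT.
  have y_src : (0 < source y (tsource d))%N by apply/source_gt0P; exists d.
  have sub : connect (step y) A \subset connect (step y) (tsource d).
    by apply/fintype.subsetP => q'; apply: connect_trans d_A.
  have := geq_leqif (subset_leqif_card sub).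
  rewrite (max_A _ y_src : (_ <= _)%N = true) => /esym.
  by move/fintype.subsetP/(_ (tsource d)); apply; exact: connect0.
pose h1 : vec := [ffun d => if K (tsource d) then y d else 0%N].
pose ok (g : vec) : Prop :=
  [/\ forall d, (h1 d <= g d <= y d)%N,
      forall q, (source g q <= target g q)%N
    & forall q, (0 < source g q)%N -> connect (step g) A q].
(* A path from [A] whose end leads back to [A] stays in [K], so its transitions all belong to
   [h1]. *)
have h1_path s x : connect (step y) A x -> path (step y) x s ->
    connect (step y) (last x s) A -> connect (step h1) x (last x s).
  elim: s x => [|z s IHs] x A_x /=; first by rewrite connect0.
  case/andP=> x_z path_s last_A.
  have A_z := connect_trans A_x (connect1 x_z).
  apply: connect_trans (IHs z A_z path_s last_A); apply: connect1.
  have z_last : connect (step y) z (last z s) by apply/connectP; exists s.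
  have x_A := connect_trans (connect1 x_z) (connect_trans z_last last_A).
  case/stepP: x_z => d [y_d src_d tgt_d]; apply/stepP; exists d; split=> //.
  by rewrite ffunE src_d /K A_x x_A.
have ok_h1 : ok h1.
  split=> [d|q|q].
  - by rewrite ffunE leqnn; case: ifP => //=; rewrite leqnn.
  (* Inside [K] the vector [h1] keeps everything that [y] produces, by [K_back]; outside [K] it
     consumes nothing. *)
  - have [K_q|nK_q] := boolP (K q); last first.
      rewrite sourceE big1 // => d _; rewrite ffunE; case: ifP => [K_d|_].
        by case: eqP K_d nK_q => // -> ->.
      by rewrite muln0.
    apply: (@leq_trans (source y q)).
      by rewrite !sourceE leq_sum // => d _; rewrite ffunE leq_mul2l; case: ifP;
        rewrite ?leqnn orbT.
    rewrite bal !targetE leq_sum // => d _; rewrite ffunE; case: ifP => // nK_d.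
    have [->|y_d] := posnP (y d); first by rewrite muln0.
    have [->//|t_d] := posnP (ttarget d q).
    by rewrite (K_back d q) in nK_d.
  - case/source_gt0P => d; rewrite ffunE; case: ifP => // K_d y_d src_d.
    rewrite {}src_d in K_d; case/andP: (K_d) => /connectP[s path_s ->] q_A.
    by apply: h1_path.
have grow n g : ok g -> (\sum_d (y d - g d) < n)%N ->
    exists2 g', ok g' & balanced g'.
  elim: n g => // n IHn g ok_g; rewrite ltnS => le_n.
  have [/eqfunP bal_g|/forallPn[q0 neq]] :=
    boolP [forall q, source g q == target g q]; first by exists g.
  have [le_g sub_g conn_g] := ok_g.
  have lt_q0 : (source g q0 < target g q0)%N by rewrite ltn_neqAle neq sub_g.
  (* As [g <= y] and [y] is balanced, some transition of [y] from the overproduced [q0] is not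
     exhausted by [g]. Adding it preserves [ok], since [q0] is already reached. *)
  have : (source g q0 < source y q0)%N.
    apply: leq_trans lt_q0 _; rewrite bal !targetE leq_sum // => d _.
    by rewrite leq_mul2l; case/andP: (le_g d) => _ ->; rewrite orbT.
  rewrite !sourceE => lt_src.
  have [d /andP[/eqP src_d lt_d]] :
      exists d, (tsource d == q0) && (g d < y d)%N.
    apply/existsP; apply: contraLR lt_src => /existsPn none.
    rewrite -leqNgt leq_sum // => d _; have := none d.
    by case: eqP => //= _; rewrite -leqNgt !mul1n.
  pose e : vec := [ffun d' => (d' == d) : nat].
  have src_e q : source e q = (tsource d == q) :> nat.
    rewrite sourceE (bigD1 d) //= big1 ?ffunE ?eqxx ?muln1 ?addn0 //.
    by move=> d' /negbTE neq_d; rewrite ffunE neq_d muln0.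
  have tgt_e q : target e q = ttarget d q.
    rewrite targetE (bigD1 d) //= big1 ?ffunE ?eqxx ?muln1 ?addn0 //.
    by move=> d' /negbTE neq_d; rewrite ffunE neq_d muln0.
  have conn_ge q : connect (step g) A q -> connect (step (g + e)) A q.
    by apply: step_connect_sub => d'; rewrite vecDE addn_gt0 => ->.
  apply: (IHn (g + e)).
    split=> [d'|q|q].
    - rewrite vecDE [e d']ffunE; have /andP[h1_g g_y] := le_g d'.
      rewrite (leq_trans h1_g) ?leq_addr //=.
      by case: eqP => [->|_]; rewrite ?addn1 // addn0.
    - rewrite sourceD targetD src_e src_d.
      case: eqP => [<-|_]; last by rewrite addn0 (leq_trans (sub_g q)) ?leq_addr.
      by rewrite addn1 (leq_trans lt_q0) ?leq_addr.
    - rewrite sourceD addn_gt0 => /orP[/conn_g/conn_ge //|].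
      rewrite src_e src_d lt0b => /eqP <-.
      have /target_gt0P[d' g_d' tgt_d'] : (0 < target g q0)%N.
        exact: leq_ltn_trans lt_q0.
      apply: conn_ge; apply: connect_trans (conn_g (tsource d') _) _.
        by apply/source_gt0P; exists d'.
      by apply/connect1/stepP; exists d'.
  apply: leq_trans le_n; rewrite (bigD1 d) //= [X in (_ < X)%N](bigD1 d) //=.
  rewrite -addSn; apply: leq_add.
    by rewrite vecDE ffunE eqxx; lia.
  by apply: leq_sum => d' _; rewrite vecDE leq_sub2l ?leq_addr.
have [g [le_g _ conn_g] bal_g] := grow _ h1 ok_h1 (ltnSn _).
exists g, A; split=> [d||//|//]; first by case/andP: (le_g d).
have /source_gt0P[d y_d src_d] := y_A; exists d.
apply: leq_trans (_ : h1 d <= g d)%N; last by case/andP: (le_g d).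
by rewrite ffunE src_d K_A.
Qed.
End Runs.

(** * Counting the transitions of a grammar in normal form *)

Section Counting.
Variables (Sigma : finType) (G : cgrammar Sigma).
Notation Q := (nonterm G).

Lemma msingle_peel (t : {ffun Q -> nat}) :
  t = 0 \/ exists q t', t = msingle q + t' /\ (\sum_q t q = (\sum_q t' q).+1)%N.
Proof.
have [/eqfunP t0|/forallPn[q nz_q]] := boolP [forall q, t q == 0%N].
  by left; apply/ffunP => q; rewrite t0 ffunE.
right; exists q, [ffun q' => (t q' - (q' == q))%N].
have tE q' : t q' = ((q' == q) + (t q' - (q' == q)))%N.
  by rewrite subnKC //; case: eqP => // ->; rewrite lt0n.
split; first by apply/ffunP => q'; rewrite !ffunE; exact: tE.
rewrite (bigD1 q) //= [in RHS](bigD1 q) //= ffunE eqxx.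
rewrite -addSn subn1 prednK ?lt0n //; congr (_ + _)%N.
by apply: eq_bigr => q' /negbTE neq; rewrite ffunE neq subn0.
Qed.

(** A transition is encoded by its source, an effect with entries in -1, 0, 1, and two optional
    target nonterminals. *)
Definition delta_bound (k N : nat) : nat := N * 3 ^ k * N.+1 ^ 2.

Lemma card_delta (N : nat) :
  normal_form G -> (#|Q| <= N)%N -> (#|{: delta G}| <= delta_bound #|Sigma| N)%N.
Proof.
move=> nf le_N.
pose C := (Q * {ffun Sigma -> 'I_3} * (option Q * option Q))%type.
pose single (o : option Q) : {ffun Q -> nat} := if o is Some q then msingle q else 0.
pose decode (c : C) : Q * {ffun Sigma -> int} * {ffun Q -> nat} :=
  (c.1.1, [ffun x => (c.1.2 x)%:Z - 1], single c.2.1 + single c.2.2).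
apply: (@leq_trans #|{: C}|); last first.
  rewrite !card_prod card_ffun !card_option card_ord.
  by rewrite /delta_bound -mulnn !leq_mul ?leqnn // ltnS.
rewrite -(size_codom decode) -cardfE; apply: uniq_leq_size.
  exact: fset_uniq.
move=> d dG; have [] := nf [` dG]%fset.
rewrite /ttarget /teffect /= /norm1; case: d dG => -[q a] t dG /= le_t le_a.
have le1 x : (`|a x| <= 1)%N by apply: leq_trans le_a; rewrite (bigD1 x) //= leq_addr.
have {le_t} le_t : (\sum_q t q <= 2)%N.
  by apply: leq_trans le_t; apply: leq_sum => q' _; rewrite ffunE.
have [o1 [o2 tE]] : exists o1 o2, t = single o1 + single o2.
  have [->|[q1 [t1 [tE sum_t]]]] := msingle_peel t.
    by exists None, None; rewrite addr0.
  have [t10|[q2 [t2 [t1E sum_t1]]]] := msingle_peel t1.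
    by exists (Some q1), None; rewrite tE t10.
  have [t20|[q3 [t3 [t2E sum_t2]]]] := msingle_peel t2.
    by exists (Some q1), (Some q2); rewrite tE t1E t20 addr0.
  by move: le_t; rewrite sum_t sum_t1 sum_t2.
apply/codomP; exists (q, [ffun x => inord `|(a x + 1)%R|%N], (o1, o2)).
rewrite /decode /= tE; congr (_, _, _); apply/ffunP => x; rewrite !ffunE.
have := le1 x; move: (a x : int) => z le_z; rewrite inordK; lia.
Qed.
Lemma teffect_le (nf : normal_form G) (d : delta G) x : (`|teffect d x| <= 1)%N.
Proof.
by have [_] := nf d; apply: leq_trans; rewrite /norm1 (bigD1 x) //= leq_addr.
Qed.

Lemma flow_coef_le (nf : normal_form G) q (d : delta G) : (`|flow_coef q d| <= 3)%N.
Proof.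
have [le_t _] := nf d; have : (ttarget d q <= 2)%N.
  apply: leq_trans le_t; rewrite /norm1 (bigD1 q) //= ffunE.
  by rewrite absz_nat leq_addr.
by rewrite /flow_coef; case: eqP => _; lia.
Qed.

End Counting.

(** * Decomposition of runs into short cycles *)

Section Decomposition.
Variables (Sigma : finType) (G : cgrammar Sigma) (n : nat).
Hypotheses (nf : normal_form G) (le_n : (#|{: delta G}| <= n)%N).
Notation Q := (nonterm G).
Notation vec := {ffun delta G -> nat}.
Implicit Types (R h y : vec) (p q A : Q) (d : delta G).

Lemma Psi_le R c x : (forall d, (R d <= c)%N) -> (`|Psi R x| <= n * c)%N.
Proof.
move=> le_c; rewrite PsiE; apply: leq_trans (absz_sum_le _ _) _.
apply: (@leq_trans (\sum_(d : delta G) c)).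
  by apply: leq_sum => d _; rewrite abszM -[c]mul1n leq_mul ?(teffect_le nf) ?le_c.
by rewrite sum_nat_const leq_mul2r le_n orbT.
Qed.

(** In this bound and the next, 3 bounds the flow coefficients, 1 the right-hand side of the flow
    equation, and 2 is the factor of [run_sub_balanced]. *)
Definition cycle_bound (m : nat) : nat := kbound m.+1 3.
Definition base_bound (m : nat) : nat := xbound m 3 1 2.

(** A direction of the flow system is balanced but possibly disconnected; [balanced_cycle] takes
    from it a piece reachable from one nonterminal of [R]. *)
Lemma extract_cycle R p d0 :
  is_run R p -> (base_bound n < R d0)%N ->
  exists h A, [/\ cycle_at A h, (0 < source R A)%N, exists d, (0 < h d)%N,
      forall d, (h d <= cycle_bound n)%N & forall d, (2 * h d <= R d)%N].
Proof.
move=> /is_runP[flow _] big_R.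
have [||y [ker_y y_d0 le_y le_2y]] := @kernel_direction _ _
  (fun q d => flow_coef q d) _ 3 1 2 n R d0 isT le_n _ _ flow big_R.
- by move=> q d; apply: flow_coef_le nf q d.
- by move=> q; case: eqP.
have [||h [A [le_h nz_h y_A cyc_h]]] := @balanced_cycle _ G (finfun y) d0.
- by apply/balancedP => q; rewrite -[RHS](ker_y q); under eq_bigr do rewrite ffunE.
- by rewrite ffunE.
have {}le_h d : (h d <= y d)%N by have := le_h d; rewrite ffunE.
exists h, A; split=> //.
- have /source_gt0P[d] := y_A; rewrite ffunE => y_d src_d.
  apply/source_gt0P; exists d => //.
  by have := le_2y d; lia.
- by move=> d; apply: leq_trans (le_y d).
- by move=> d; apply: leq_trans (le_2y d); rewrite leq_mul2l le_h.
Qed.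

(** Makes the short vectors a finite index type, as needed for [integer_caratheodory]. *)
Definition of_bounded (c : nat) (t : {ffun delta G -> 'I_c.+1}) : vec :=
  [ffun d => t d : nat].

(** Short cycles are peeled off until every multiplicity is small. What remains is always a run
    below [R], so each cycle is based at a nonterminal of the original [R]. *)
Lemma run_decomposition R p :
  is_run R p ->
  exists R0 (m : {ffun delta G -> 'I_(cycle_bound n).+1} -> nat),
    [/\ forall d, (R0 d <= base_bound n)%N,
        forall x, Psi R x =
          Psi R0 x + \sum_t Psi (of_bounded t) x * (m t)%:Z
      & forall t, m t != 0%N ->
          exists A, (0 < source R A)%N /\ cycle_at A (of_bounded t)].
Proof.
have [s] := ubnP (\sum_d R d)%N.
elim: s R => // s IHs R; rewrite ltnS => le_s run_R.
have [/forallP small|/forallPn[d0]] :=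
  boolP [forall d, (R d <= base_bound n)%N].
  exists R, (fun _ => 0%N); split=> // x.
  by rewrite big1 ?addr0 // => t _; rewrite mulr0.
rewrite -ltnNge => big_R.
have [h [A [cyc_h R_A [d1 h_d1] le_h le_2h]]] := extract_cycle run_R big_R.
pose R' : vec := [ffun d => (R d - h d)%N].
have run_R' : is_run R' p by apply: run_sub_balanced => //; case: cyc_h.
have [|R0 [m [le_R0 PsiR' cyc_m]]] := IHs R' _ run_R'.
  exact: leq_trans (sum_sub_lt le_2h h_d1) le_s.
have RE : R = R' + h by rewrite subvecK.
pose th : {ffun delta G -> 'I_(cycle_bound n).+1} := [ffun d => inord (h d)].
have thE : of_bounded th = h.
  by apply/ffunP => d; rewrite !ffunE inordK // ltnS.
exists R0, (fun t => m t + (t == th))%N; split=> // [x|t].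
  rewrite {1}RE PsiD PsiR' -addrA; congr (_ + _).
  under [in RHS]eq_bigr do rewrite PoszD mulrDr.
  rewrite big_split /=; congr (_ + _).
  rewrite (bigD1 th) //= eqxx mulr1 thE big1 ?addr0 // => t /negbTE ->.
  by rewrite mulr0.
have [->|neq] := eqVneq t th; first by exists A; rewrite thE.
rewrite addn0 => /cyc_m[A' [R'_A' cyc]]; exists A'; split=> //.
by apply: leq_trans R'_A' _; rewrite RE sourceD leq_addr.
Qed.

Lemma sum_seq_ord (T : Type) (s : seq T) (k : nat) (F : T -> int) :
  (size s <= k)%N ->
  \sum_(t <- s) F t = \sum_(j < k) oapp F 0 (onth s j).
Proof.
elim: s k => [|x s IHs] k.
  by move=> _; rewrite big_nil big1 // => j _; case: j => -[].
case: k => // k le_k; rewrite big_cons big_ord_recl /=; congr (_ + _).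
exact: IHs.
Qed.

Definition effect_bound (m : nat) : nat := m * cycle_bound m.

(** The effect of the residual run, plus that of all short cycles whose coefficient is small after
    [integer_caratheodory]. *)
Definition error_bound (k m : nat) : nat :=
  m * base_bound m
  + (cycle_bound m).+1 ^ m * (kbound k.+1 (effect_bound m) * effect_bound m).

(** At most [#|Sigma|] cycles keep a large coefficient; everything else goes into the error. As this
    number does not depend on the grammar, there are only polynomially many tuples [s]. *)
Lemma run_approximation R p :
  is_run R p ->
  exists (s : 'I_#|Sigma| -> Q) (h : 'I_#|Sigma| -> vec) (c : 'I_#|Sigma| -> nat),
    [/\ forall j, (0 < source R (s j))%N,
        forall j, cycle_at (s j) (h j),
        forall j d, (h j d <= cycle_bound n)%N
      & forall x, (`|(Psi R x - \sum_j Psi (h j) x * (c j)%:Z)%R|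
                   <= error_bound #|Sigma| n)%N].
Proof.
move=> run_R; have [R0 [m [le_R0 PsiR cyc_m]]] := run_decomposition run_R.
have le_eff (t : {ffun delta G -> 'I_(cycle_bound n).+1}) x :
    (`|Psi (of_bounded t) x| <= effect_bound n)%N.
  by apply: Psi_le => d; rewrite ffunE; exact: leq_ord.
have [m' [eq_m' supp_m' few]] :=
  @integer_caratheodory Sigma _ (fun t x => Psi (of_bounded t) x) _ m le_eff.
set H := kbound _ _ in few; set B := [set t | _]%SET in few.
have mB t : t \in B -> m t != 0%N.
  by rewrite inE; apply: contraTneq => /supp_m' ->.
have /fin_all_exists[f fP] : forall j : 'I_#|Sigma|,
    exists shc : Q * vec * nat,
      [/\ (0 < source R shc.1.1)%N, cycle_at shc.1.1 shc.1.2,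
          forall d, (shc.1.2 d <= cycle_bound n)%N
        & forall x, Psi shc.1.2 x * (shc.2)%:Z =
            oapp (fun t => Psi (of_bounded t) x * (m' t)%:Z) 0 (onth (enum B) j)].
  move=> j; case t_j: (onth (enum B) j) => [t|] /=.
    have tB : t \in B.
      rewrite -mem_enum; apply/(nthP t); exists j.
        by rewrite -onthTE t_j.
      exact: onth_nth.
    have [A [R_A cyc_A]] := cyc_m t (mB t tB).
    by exists (A, of_bounded t, m' t); split=> //= d; rewrite ffunE; exact: leq_ord.
  (* Indices beyond the large cycles are padded with the zero cycle at [p], which is a source of
     every run from [p]. *)
  exists (p, 0, 0%N); split=> //=.
  - exact: start_source run_R.
  - exact: cycle0.
  - by move=> d; rewrite ffunE.
  - by move=> x; rewrite mulr0.
exists (fun j => (f j).1.1), (fun j => (f j).1.2), (fun j => (f j).2).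
split=> [j|j|j d|x]; [by case: (fP j)..|].
rewrite PsiR -eq_m' (bigID (mem B)) /=.
have -> : \sum_(t in B) Psi (of_bounded t) x * (m' t)%:Z =
    \sum_j Psi (f j).1.2 x * ((f j).2)%:Z.
  rewrite -big_enum (@sum_seq_ord _ _ #|Sigma|) -?cardE //.
  by apply: eq_bigr => j _; case: (fP j).
rewrite addrCA addrAC subrr add0r /error_bound.
set rest := \sum_(t | _) _.
apply: leq_trans (_ : (`|Psi R0 x| + `|rest| <= _)%N); first by lia.
apply: leq_add; first exact: Psi_le.
apply: leq_trans (absz_sum_le _ _) _.
apply: (@leq_trans (\sum_(t : {ffun delta G -> 'I_(cycle_bound n).+1})
    H * effect_bound n)).
  rewrite [X in (_ <= X)%N](bigID (mem B)) /= (leq_trans _ (leq_addl _ _)) //.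
  apply: leq_sum => t; rewrite inE -leqNgt => le_m'.
  by rewrite abszM mulnC leq_mul.
rewrite sum_nat_const leq_mul2r; apply/orP; right.
by rewrite card_ffun card_ord leq_pexp2l.
Qed.
End Decomposition.

(** * Descent *)

Section CycleSums.
Variables (Sigma : finType) (G : cgrammar Sigma).
Notation vec := {ffun delta G -> nat}.

Lemma Psi_sum (T : Type) (r : seq T) (h : T -> vec) (c : T -> nat) x :
  Psi (\sum_(j <- r) h j *+ c j) x = \sum_(j <- r) Psi (h j) x * (c j)%:Z.
Proof.
have Psi0 : Psi (0 : vec) x = 0.
  by rewrite PsiE big1 // => d _; rewrite ffunE mulr0.
elim: r => [|j r IHr]; rewrite ?big_nil ?big_cons // PsiD IHr; congr (_ + _).
elim: (c j) => [|n IHn]; first by rewrite mulr0n Psi0 mulr0.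
by rewrite mulrS PsiD IHn intS mulrDr mulr1.
Qed.

Lemma run_add_cycles (T : Type) (r : seq T) (A : T -> nonterm G) (h : T -> vec)
    (c : T -> nat) (R : vec) p :
  is_run R p -> (forall j, 0 < source R (A j))%N ->
  (forall j, cycle_at (A j) (h j)) -> is_run (R + \sum_(j <- r) h j *+ c j) p.
Proof.
move=> run_R R_A cyc; elim: r => [|j r IHr]; first by rewrite big_nil addr0.
rewrite big_cons addrCA addrC; apply: run_add_cycle IHr _ (cycleMn _ (cyc j)).
by rewrite sourceD (leq_trans (R_A j)) ?leq_addr.
Qed.

End CycleSums.

(** * Descent for disjointness *)

Section Disjointness.
Variables (Sigma : finType) (G1 G2 : cgrammar Sigma) (n : nat).
Hypotheses (nf1 : normal_form G1) (nf2 : normal_form G2).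
Hypotheses (le_n1 : (#|{: delta G1}| <= n)%N) (le_n2 : (#|{: delta G2}| <= n)%N).

Definition common_bound (m : nat) : nat := xbound (m + m) 3 1 2.

(** Both flow equations and the equality of effects form one linear system. A direction of it is a
    pair of balanced vectors with equal effects, subtracted from both runs. Bounding [R1'] suffices
    to bound the common word. *)
Lemma small_common_run (R1 : {ffun delta G1 -> nat}) (R2 : {ffun delta G2 -> nat})
    p1 p2 :
  is_run R1 p1 -> is_run R2 p2 -> Psi R1 = Psi R2 ->
  exists (R1' : {ffun delta G1 -> nat}) (R2' : {ffun delta G2 -> nat}),
    [/\ is_run R1' p1, is_run R2' p2, Psi R1' = Psi R2'
      & forall d, (R1' d <= common_bound n)%N].
Proof.
have [s] := ubnP (\sum_d R1 d)%N.
elim: s R1 R2 => // s IHs R1 R2; rewrite ltnS => le_s run1 run2 eq_Psi.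
have [/forallP small|/forallPn[d0]] :=
  boolP [forall d, (R1 d <= common_bound n)%N]; first by exists R1, R2; split.
rewrite -ltnNge => big_R1.
pose a (i : nonterm G1 + nonterm G2 + Sigma) (j : delta G1 + delta G2) : int :=
  match i, j with
  | inl (inl q), inl d => flow_coef q d
  | inl (inr q), inr d => flow_coef q d
  | inr x, inl d => teffect d x
  | inr x, inr d => - teffect d x
  | _, _ => 0
  end.
pose b (i : nonterm G1 + nonterm G2 + Sigma) : int :=
  match i with
  | inl (inl q) => (q == p1)%:Z
  | inl (inr q) => (q == p2)%:Z
  | inr x => 0
  end.
pose pair_sum (y1 : delta G1 -> nat) (y2 : delta G2 -> nat) j :=
  match j with inl d => y1 d | inr d => y2 d end.
have aE y1 y2 i : \sum_j a i j * (pair_sum y1 y2 j)%:Z =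
    match i with
    | inl (inl q) => \sum_d flow_coef q d * (y1 d)%:Z
    | inl (inr q) => \sum_d flow_coef q d * (y2 d)%:Z
    | inr x => Psi (finfun y1) x - Psi (finfun y2) x
    end.
  rewrite big_sumType /=; case: i => [[q|q]|x] /=.
  - by rewrite [X in _ + X]big1 ?addr0 // => d _; rewrite mul0r.
  - by rewrite [X in X + _]big1 ?add0r // => d _; rewrite mul0r.
  - rewrite !PsiE; under [in RHS]eq_bigr do rewrite ffunE.
    under [in X in _ = _ - X]eq_bigr do rewrite ffunE.
    by rewrite -sumrN; congr (_ + _); apply: eq_bigr => d _; rewrite mulNr.
have eq_b i : \sum_j a i j * (pair_sum R1 R2 j)%:Z = b i.
  rewrite aE; case: i => [[q|q]|x] /=.
  - by have /is_runP[->] := run1.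
  - by have /is_runP[->] := run2.
  - by rewrite !ffunK eq_Psi subrr.
have [||||y [ker_y y_d0 _ le_2y]] :=
  @kernel_direction _ _ a b 3 1 2 (n + n) _ (inl d0) isT _ _ _ eq_b.
- by rewrite card_sum leq_add.
- move=> [[q|q]|x] [d|d] //=; try exact: flow_coef_le.
    by apply: leq_trans (teffect_le nf1 d x) _.
  by rewrite abszN; apply: leq_trans (teffect_le nf2 d x) _.
- by move=> [[q|q]|x] //=; case: eqP.
- exact: big_R1.
pose y1 d := y (inl d); pose y2 d := y (inr d).
have {}ker_y i : \sum_j a i j * (pair_sum y1 y2 j)%:Z = 0.
  by rewrite -[RHS](ker_y i); apply: eq_bigr => -[d|d] _.
have bal1 : balanced (finfun y1).
  apply/balancedP => q; have := ker_y (inl (inl q)); rewrite aE => ker_q.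
  by rewrite -[RHS]ker_q; apply: eq_bigr => d _; rewrite ffunE.
have bal2 : balanced (finfun y2).
  apply/balancedP => q; have := ker_y (inl (inr q)); rewrite aE => ker_q.
  by rewrite -[RHS]ker_q; apply: eq_bigr => d _; rewrite ffunE.
have le1 d : (2 * finfun y1 d <= R1 d)%N by rewrite ffunE; exact: (le_2y (inl d)).
have le2 d : (2 * finfun y2 d <= R2 d)%N by rewrite ffunE; exact: (le_2y (inr d)).
apply: IHs (run_sub_balanced run1 bal1 le1) (run_sub_balanced run2 bal2 le2) _.
  by apply: leq_trans (@sum_sub_lt _ _ _ _ d0 le1 _) le_s; rewrite ffunE.
apply/ffunP => x; rewrite !Psi_sub // eq_Psi; congr (_ - _).
by apply/eqP; rewrite -subr_eq0; have := ker_y (inr x); rewrite aE => ->.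
Qed.

End Disjointness.

(** * Descent for inclusion *)

Section Inclusion.
Variables (Sigma : finType) (G1 G2 : cgrammar Sigma) (n N : nat).
Hypotheses (nf1 : normal_form G1) (nf2 : normal_form G2).
Hypotheses (le_n1 : (#|{: delta G1}| <= n)%N) (le_n2 : (#|{: delta G2}| <= n)%N).
Hypothesis le_N : (#|nonterm G2| <= N)%N.
Local Notation k := #|Sigma|.
Local Notation Q1 := (nonterm G1).
Local Notation Q2 := (nonterm G2).
Local Notation vec1 := {ffun delta G1 -> nat}.
Local Notation vec2 := {ffun delta G2 -> nat}.

(** One unknown per transition, and [k] cycle coefficients for each of the at most [N ^ k] tuples of
    nonterminals. *)
Definition nb_unknowns (k n N : nat) : nat := n + N ^ k * k.
Definition coef_bound (n : nat) : nat := effect_bound n + 3.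
(** The error for [R - y] plus the effect of [y]. This is not circular: the size of [y] depends on
    the coefficients of the system, not on this bound on its right-hand side. *)
Definition shift_bound (k n N : nat) : nat :=
  error_bound k n + n * kbound (nb_unknowns k n N).+1 (coef_bound n).
Definition inclusion_bound (k n N : nat) : nat :=
  xbound (nb_unknowns k n N) (coef_bound n) (shift_bound k n N + 1) 2.

(** [y] is chosen before [R2], so one direction serves all runs of [G2]. Only the nonterminals of
    the cycles approximating [R2] matter: the cycles inserted are those fixed for the same tuple. *)
Lemma common_direction (R : vec1) p1 d0 :
  is_run R p1 -> (inclusion_bound k n N < R d0)%N ->
  exists y : vec1,
    [/\ balanced y, (0 < y d0)%N, forall d, (2 * y d <= R d)%N
      & forall (R2 : vec2) p2, is_run R2 p2 ->
          Psi R2 = Psi [ffun d => (R d - y d)%N] ->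
          exists2 R2' : vec2, is_run R2' p2 & Psi R2' = Psi R].
Proof.
move=> run_R big_R.
pose near (s : {ffun 'I_k -> Q2}) (hc : ('I_k -> vec2) * ('I_k -> nat)) : Prop :=
  [/\ forall j, cycle_at (s j) (hc.1 j),
      forall j d, (hc.1 j d <= cycle_bound n)%N
    & forall x, (`|(Psi R x - \sum_j Psi (hc.1 j) x * (hc.2 j)%:Z)%R|
                 <= shift_bound k n N)%N].
(* By excluded middle, the flag [bhc.1] records whether [s] admits a near combination, and [bhc.2]
   is one if so. *)
have /fin_all_exists[f fP] : forall s,
    exists bhc : bool * (('I_k -> vec2) * ('I_k -> nat)),
    (bhc.1 -> near s bhc.2) /\ (forall hc, near s hc -> bhc.1).
  move=> s; have [[hc near_hc]|none] := boolp.EM (exists hc, near s hc).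
    by exists (true, hc).
  exists (false, (fun _ => 0, fun _ => 0%N)); split=> // hc near_hc.
  by case: none; exists hc.
pose good s := (f s).1; pose h s := (f s).2.1; pose c s := (f s).2.2.
have nearP s : good s -> near s (h s, c s).
  by case: (fP s) => near_f _ /near_f; rewrite /h /c; case: (f s).2.
(* Rows: the flow equation and, for each good [s], the effect of the run minus the combination at
   [s]; rows of other [s] are zero. *)
pose a (i : Q1 + {ffun 'I_k -> Q2} * Sigma)
    (j : delta G1 + {ffun 'I_k -> Q2} * 'I_k) : int :=
  match i, j with
  | inl q, inl d => flow_coef q d
  | inl q, inr sj => 0
  | inr sx, inl d => if good sx.1 then teffect d sx.2 else 0
  | inr sx, inr sj =>
      if good sx.1 && (sj.1 == sx.1) then - Psi (h sj.1 sj.2) sx.2 else 0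
  end.
pose b (i : Q1 + {ffun 'I_k -> Q2} * Sigma) : int :=
  match i with
  | inl q => (q == p1)%:Z
  | inr sx => if good sx.1 then
      Psi R sx.2 - \sum_j Psi (h sx.1 j) sx.2 * (c sx.1 j)%:Z else 0
  end.
pose pair_sum (y : delta G1 -> nat) (m : {ffun 'I_k -> Q2} -> 'I_k -> nat)
    (j : delta G1 + {ffun 'I_k -> Q2} * 'I_k) : nat :=
  match j with inl d => y d | inr sj => m sj.1 sj.2 end.
have aE (y : vec1) m i : \sum_j a i j * (pair_sum y m j)%:Z =
    match i with
    | inl q => \sum_d flow_coef q d * (y d)%:Z
    | inr sx => if good sx.1 then
        Psi y sx.2 - \sum_j Psi (h sx.1 j) sx.2 * (m sx.1 j)%:Z else 0
    end.
  rewrite big_sumType /=; case: i => [q|[s x]] /=.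
    by rewrite [X in _ + X]big1 ?addr0 // => sj _; rewrite mul0r.
  case: ifP => good_s; last first.
    by rewrite !big1 ?addr0 // => ? _; rewrite mul0r.
  rewrite PsiE; congr (_ + _); rewrite -sumrN /=.
  rewrite -(pair_bigA _ (fun s' j =>
    (if s' == s then - Psi (h s' j) x else 0) * (m s' j)%:Z)) /=.
  rewrite (bigD1 s) //= eqxx [X in _ + X]big1 ?addr0; last first.
    by move=> s' /negbTE ->; rewrite big1 // => j _; rewrite mul0r.
  by apply: eq_bigr => j _; rewrite mulNr.
have eq_b i : \sum_j a i j * (pair_sum R c j)%:Z = b i.
  rewrite aE; case: i => [q|sx] //.
  by have /is_runP[->] := run_R.
have [|||||y [ker_y y_d0 le_y le_2y]] :=
  @kernel_direction _ _ a b (coef_bound n) (shift_bound k n N + 1) 2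
    (nb_unknowns k n N) _ (inl d0) _ _ _ _ eq_b.
- by rewrite /coef_bound addn_gt0 orbT.
- rewrite card_sum card_prod card_ffun !card_ord leq_add // leq_mul //.
  by case: {+}k => // k'; rewrite leq_exp2r.
- move=> [q|[s x]] [d|[s' j]] //=; rewrite /coef_bound.
  + by rewrite (leq_trans (flow_coef_le nf1 q d)) ?leq_addl.
  + by case: ifP => // _; rewrite (leq_trans (teffect_le nf1 d x)) ?addn3.
  + case: ifP => // /andP[good_s /eqP ->]; rewrite abszN.
    apply: leq_trans (leq_addr _ _); apply: Psi_le => // d.
    by have [_ le_h _] := nearP s good_s; exact: le_h.
- move=> [q|[s x]] /=; first by case: eqP => _; rewrite ?addn1.
  case: ifP => // good_s; apply: leq_trans (leq_addr _ _).
  by have [_ _ approx] := nearP s good_s; exact: approx.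
- exact: big_R.
pose y1 : vec1 := [ffun d => y (inl d)]; pose m s j := y (inr (s, j)).
have {}ker_y i : \sum_j a i j * (pair_sum y1 m j)%:Z = 0.
  by rewrite -[RHS](ker_y i); apply: eq_bigr => -[d|[s j]] _; rewrite /= ?ffunE.
have le1 d : (2 * y1 d <= R d)%N by rewrite ffunE; exact: (le_2y (inl d)).
exists y1; split=> //.
- by apply/balancedP => q; have := ker_y (inl q); rewrite aE.
- by rewrite ffunE.
move=> R2 p2 run_R2 eq_Psi.
have [s' [h' [c' [src cyc le_h' approx]]]] := run_approximation nf2 le_n2 run_R2.
pose s := [ffun j => s' j].
(* The combination near [Psi R2 = Psi R - Psi y1] is also near [Psi R], within [shift_bound]. *)
have good_s : good s.
  case: (fP s) => _ /(_ (h', c')); apply; split=> [j|j d|x] /=; first 1 last.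
  - exact: (le_h' j d).
  - have le_Psi : (`|Psi y1 x| <= n * kbound (nb_unknowns k n N).+1 (coef_bound n))%N.
      by apply: Psi_le => // d; rewrite ffunE.
    have := approx x; rewrite eq_Psi Psi_sub // /shift_bound /=.
    move: le_Psi; move: (\sum_j _) (n * _)%N (error_bound _ _) => S u e.
    by move: (Psi R x) (Psi y1 x) => v w; lia.
  - by rewrite ffunE; exact: cyc.
have [cyc_h _ _] := nearP s good_s.
exists (R2 + \sum_j h s j *+ m s j).
  by apply: (@run_add_cycles _ _ _ _ s) => // j; rewrite ffunE.
apply/ffunP => x; rewrite PsiD Psi_sum eq_Psi Psi_sub //.
(* The kernel row of [s] says that the inserted cycles have exactly the effect of [y1]. *)
have := ker_y (inr (s, x)); rewrite aE /= good_s => /eqP.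
by rewrite subr_eq0 => /eqP ->; rewrite subrK.
Qed.

Lemma inclusion_from_small p1 p2 :
  (forall R1 : vec1, is_run R1 p1 ->
     (forall d, (R1 d <= inclusion_bound k n N)%N) ->
     exists2 R2 : vec2, is_run R2 p2 & Psi R2 = Psi R1) ->
  forall R1 : vec1, is_run R1 p1 ->
    exists2 R2 : vec2, is_run R2 p2 & Psi R2 = Psi R1.
Proof.
move=> small_in R1; have [s] := ubnP (\sum_d R1 d)%N.
elim: s R1 => // s IHs R1; rewrite ltnS => le_s run1.
have [/forallP|/forallPn[d0]] :=
  boolP [forall d, (R1 d <= inclusion_bound k n N)%N]; first exact: small_in.
rewrite -ltnNge => big_R1.
have [y [bal y_d0 le_2y transfer]] := common_direction run1 big_R1.
have [|R2 run2 eq_Psi] := IHs _ _ (run_sub_balanced run1 bal le_2y).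
  exact: leq_trans (sum_sub_lt le_2y y_d0) le_s.
exact: transfer run2 eq_Psi.
Qed.

End Inclusion.

(** * Single exponential bounds *)

Section Growth.

Definition poly_bounded (f : nat -> nat) : Prop :=
  exists p : {poly nat}, forall N, (f N <= p.[N])%N.

Definition single_exp (f : nat -> nat) : Prop :=
  exists p : {poly nat}, forall N, (f N <= 2 ^ p.[N])%N.

Lemma poly_bounded_const c : poly_bounded (fun _ => c).
Proof. by exists c%:P => N; rewrite hornerC. Qed.

Lemma poly_bounded_id : poly_bounded id.
Proof. by exists 'X => N; rewrite hornerX. Qed.

Lemma poly_bounded_add f g :
  poly_bounded f -> poly_bounded g -> poly_bounded (fun N => f N + g N)%N.
Proof.
by case=> p le_f [q le_g]; exists (p + q) => N; rewrite hornerD leq_add.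
Qed.

Lemma poly_bounded_mul f g :
  poly_bounded f -> poly_bounded g -> poly_bounded (fun N => f N * g N)%N.
Proof.
by case=> p le_f [q le_g]; exists (p * q) => N; rewrite hornerM leq_mul.
Qed.

Lemma poly_bounded_expn f k :
  poly_bounded f -> poly_bounded (fun N => f N ^ k)%N.
Proof.
move=> pf; elim: k => [|k IHk]; first exact: poly_bounded_const.
have [p le_p] := poly_bounded_mul pf IHk.
by exists p => N; rewrite expnS.
Qed.

Lemma single_exp_poly f : poly_bounded f -> single_exp f.
Proof.
case=> p le_f; exists p => N.
by apply: leq_trans (le_f N) _; apply: ltnW; apply: ltn_expl.
Qed.

Lemma single_exp_add f g :
  single_exp f -> single_exp g -> single_exp (fun N => f N + g N)%N.
Proof.
case=> p le_f [q le_g]; exists (p + q + 1) => N; rewrite !hornerD hornerC.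
rewrite [(_ + 1)%R]addn1 expnS mul2n -addnn.
apply: leq_add; [apply: leq_trans (le_f N) _|apply: leq_trans (le_g N) _].
  by rewrite leq_pexp2l ?leq_addr.
by rewrite leq_pexp2l ?leq_addl.
Qed.

Lemma single_exp_mul f g :
  single_exp f -> single_exp g -> single_exp (fun N => f N * g N)%N.
Proof.
case=> p le_f [q le_g]; exists (p + q) => N.
by rewrite hornerD expnD leq_mul.
Qed.

Lemma single_exp_expn f g :
  single_exp f -> poly_bounded g -> single_exp (fun N => f N ^ g N)%N.
Proof.
case=> p le_f [q le_g]; exists (p * q) => N.
rewrite hornerM expnM; apply: (@leq_trans ((2 ^ p.[N]) ^ g N)).
  by case: (g N) => // m; rewrite leq_exp2r.
by rewrite leq_pexp2l ?expn_gt0.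
Qed.

Lemma single_exp_kbound n a :
  poly_bounded n -> single_exp a -> single_exp (fun N => kbound (n N) (a N)).
Proof.
move=> pn ea; apply: (single_exp_expn _ pn).
apply: single_exp_add (single_exp_poly (poly_bounded_const 2)).
apply: single_exp_mul ea; apply: single_exp_poly.
exact: poly_bounded_mul (poly_bounded_const 2) pn.
Qed.

Lemma poly_bounded_succ f : poly_bounded f -> poly_bounded (fun N => (f N).+1).
Proof.
case/poly_bounded_add/(_ (poly_bounded_const 1)) => p le_p.
by exists p => N; rewrite -addn1.
Qed.

Lemma single_exp_xbound n a b L :
  poly_bounded n -> single_exp a -> single_exp b ->
  single_exp (fun N => xbound (n N) (a N) (b N) L).
Proof.
move=> /poly_bounded_succ pn ea eb.
apply: single_exp_mul (single_exp_poly pn) _.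
apply: single_exp_add; first exact: single_exp_kbound pn (single_exp_add ea eb).
apply: single_exp_mul (single_exp_poly (poly_bounded_const L)) _.
exact: single_exp_kbound.
Qed.

(** By [Psi_le], the summands bound the words of small runs in the disjointness and inclusion
    descents respectively. *)
Definition box_bound (k N : nat) : nat :=
  let n := delta_bound k N in
  (n * common_bound n + n * inclusion_bound k n N)%N.

(** For fixed [k] every exponent involved, such as the number of transitions or of unknowns, is
    polynomial in [N], and every base is single exponential. *)
Lemma single_exp_box_bound k : single_exp (box_bound k).
Proof.
have ec c := single_exp_poly (poly_bounded_const c).
have pn : poly_bounded (delta_bound k).
  apply: poly_bounded_mul.
    exact: poly_bounded_mul poly_bounded_id (poly_bounded_const _).
  exact: poly_bounded_expn (poly_bounded_succ poly_bounded_id).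
have en := single_exp_poly pn.
have ecyc : single_exp (fun N => cycle_bound (delta_bound k N)).
  exact: single_exp_kbound (poly_bounded_succ pn) (ec 3).
have eeff : single_exp (fun N => effect_bound (delta_bound k N)).
  exact: single_exp_mul en ecyc.
have eerr : single_exp (fun N => error_bound k (delta_bound k N)).
  apply: single_exp_add.
    exact: single_exp_mul en (single_exp_xbound 2 pn (ec 3) (ec 1)).
  apply: single_exp_mul.
    apply: single_exp_expn pn; have [p le_p] := single_exp_add ecyc (ec 1).
    by exists p => N; rewrite -addn1.
  exact: single_exp_mul (single_exp_kbound (poly_bounded_const k.+1) eeff) eeff.
have punk : poly_bounded (fun N => nb_unknowns k (delta_bound k N) N).
  apply: poly_bounded_add pn _; apply: poly_bounded_mul (poly_bounded_const k).
  exact: poly_bounded_expn poly_bounded_id.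
have ecoef : single_exp (fun N => coef_bound (delta_bound k N)).
  exact: single_exp_add eeff (ec 3).
have eshift : single_exp (fun N => shift_bound k (delta_bound k N) N).
  apply: single_exp_add eerr _; apply: single_exp_mul en _.
  exact: single_exp_kbound (poly_bounded_succ punk) ecoef.
apply: single_exp_add.
  apply: single_exp_mul en _.
  exact: single_exp_xbound (poly_bounded_add pn pn) (ec 3) (ec 1).
apply: single_exp_mul en _.
exact: single_exp_xbound punk ecoef (single_exp_add eshift (ec 1)).
Qed.

End Growth.

(** * From small runs to boxes, and the conclusion *)

Section Boxes.
Variables (Sigma : finType) (G : cgrammar Sigma) (n : nat).
Hypotheses (nf : normal_form G) (le_n : (#|{: delta G}| <= n)%N).

Lemma Psi_in_box (R : {ffun delta G -> nat}) c B :
  (forall d, (R d <= c)%N) -> (n * c <= B)%N -> box B (Psi R).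
Proof.
move=> le_c le_B x; have := leq_trans (Psi_le nf le_n x le_c) le_B.
by lia.
Qed.

End Boxes.

Local Close Scope ring_scope.
Local Open Scope classical_set_scope.

Theorem theorem3p2 :
  forall k : nat,
  exists (B : nat -> nat) (p : {poly nat}),
    (forall N : nat, (B N <= 2 ^ (p.[N])%R)%N) /\
    forall (Sigma : finType), #|Sigma| = k ->
    forall (N : nat) (G1 G2 : cgrammar Sigma),
      normal_form G1 -> normal_form G2 ->
      (#|nonterm G1| <= N)%N -> (#|nonterm G2| <= N)%N ->
      (language G1 `<=` language G2 <->
       language G1 `&` box (B N) `<=` language G2 `&` box (B N)) /\
      (language G1 `&` language G2 = set0 <->
       (language G1 `&` box (B N)) `&` (language G2 `&` box (B N)) = set0).
Proof.
move=> k; have [p le_p] := single_exp_box_bound k.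
exists (box_bound k), p; split=> // Sigma <- N G1 G2 nf1 nf2 le_N1 le_N2.
have := card_delta nf1 le_N1; have := card_delta nf2 le_N2.
set n := delta_bound #|Sigma| N => le_n2 le_n1.
split; split=> [sub|small].
- exact: setSI.
- move=> _ [R1 run1 <-].
  have [R2 run2 eq_Psi] :
      exists2 R2 : {ffun delta G2 -> nat}, is_run R2 (start G2) & Psi R2 = Psi R1.
    apply: (inclusion_from_small nf1 nf2 le_n1 le_n2 le_N2 _ run1) => R run_R le_R.
    have in_box : box (box_bound #|Sigma| N) (Psi R).
      by apply: Psi_in_box nf1 le_n1 _ _ _ le_R _; rewrite leq_addl.
    have [] := small (Psi R); first by split=> //; exists R.
    by case=> R2 run2 eq_Psi _; exists R2.
  by exists R2.
- by rewrite setIACA sub set0I.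
- apply/eqP/negPn/negP => /set0P[_ [[R1 run1 <-] [R2 run2 /esym eq_Psi]]].
  have [R1' [R2' [run1' run2' eq_Psi' le_R]]] :=
    small_common_run nf1 nf2 le_n1 le_n2 run1 run2 eq_Psi.
  have in_box : box (box_bound #|Sigma| N) (Psi R1').
    by apply: Psi_in_box nf1 le_n1 _ _ _ le_R _; rewrite leq_addr.
  suff : set0 (Psi R1') by [].
  rewrite -small; split; split=> //; first by exists R1'.
  by exists R2'.
Qed.
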